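(* Let $\lambda\in\mathbb{R}$. For all $l,k\in\mathbb{Z}$ with $0\le l\le k$, $$S_{2,\lambda}(k+1,l+1)=\sum_{m=l}^{k}\langle l+1-k\lambda\rangle_{k-m,\lambda}S_{2,\lambda}(m,l).$$
   Context: For $\lambda\in\mathbb{R}$, the generalized falling factorials are $(x)_{0,\lambda}=1$, $(x)_{n,\lambda}=x(x-\lambda)\cdots(x-(n-1)\lambda)$ for $n\ge 1$; the ordinary falling factorials are $(x)_{0}=1$, $(x)_{n}=x(x-1)\cdots(x-n+1)$ for $n\ge 1$; and the degenerate rising factorials are $\langle x\rangle_{0,\lambda}=1$, $\langle x\rangle_{n,\lambda}=x(x+\lambda)\cdots(x+(n-1)\lambda)$ for $n\ge 1$. The degenerate Stirling numbers of the second kind $S_{2,\lambda}(n,k)$, $0\le k\le n$, are defined by the polynomial identity $(x)_{n,\lambda}=\sum_{k=0}^{n}S_{2,\lambda}(n,k)(x)_{k}$ for $n\ge 0$. *)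

(* Defs.v *)
From mathcomp Require Import all_boot all_order all_algebra.
From mathcomp Require Import reals.
Set Implicit Arguments.
Unset Strict Implicit.
Unset Printing Implicit Defensive.
Import GRing.Theory.
Local Open Scope ring_scope.

(* The factorials are defined over any commutative ring, so that they can be
   taken both at a scalar and at the indeterminate 'X. *)

Definition deg_falling (V : comNzRingType) (lambda x : V) (n : nat) : V :=
  \prod_(i < n) (x - i%:R * lambda).

Definition falling (V : comNzRingType) (x : V) (n : nat) : V :=
  \prod_(i < n) (x - i%:R).

Definition deg_rising (V : comNzRingType) (lambda x : V) (n : nat) : V :=
  \prod_(i < n) (x + i%:R * lambda).

(* S n k is constrained only for k <= n, where it is uniquely determined:
   see deg_stirling2_exists and deg_stirling2_unique. *)
Definition is_deg_stirling2 (R : comNzRingType) (lambda : R)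
    (S : nat -> nat -> R) : Prop :=
  forall n : nat, deg_falling lambda%:P 'X n =
    \sum_(0 <= k < n.+1) S n k *: falling ('X : {poly R}) k.

Lemma deg_stirling2_exists (R : comNzRingType) (lambda : R) :
  exists S : nat -> nat -> R, is_deg_stirling2 lambda S.
Proof.
pose step n (f : nat -> R) k :=
  (if k is j.+1 then f j else 0) + (k%:R - n%:R * lambda) * f k.
pose S := fix S n := if n is m.+1 then step m (S m) else fun k => (k == 0)%:R.
have S0 n k : (n < k)%N -> S n k = 0.
  elim: n k => [|n IH] [|k] //= ltnk.
  by rewrite /step !IH ?mulr0 ?addr0 // ltnW.
exists S; elim=> [|n IH].
  by rewrite big_nat1 /deg_falling /falling !big_ord0 scale1r.
rewrite /deg_falling big_ord_recr /= -/(deg_falling _ _ _) IH mulr_suml.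
rewrite (eq_bigr (fun k => S n k *: falling ('X : {poly R}) k.+1
   + ((k%:R - n%:R * lambda) * S n k) *: falling ('X : {poly R}) k)); last first.
  move=> k _; rewrite [falling _ k.+1]/falling big_ord_recr /= -/(falling _ _).
  rewrite -!mul_polyC !(polyCM, polyCB, polyC_natr).
  move: (S n k)%:P (falling _ k) k%:R n%:R lambda%:P => a b c d e.
  rewrite !mulrBr mulrBl mulrBl -!mulrA !(mulrCA c) !(mulrCA _ a) !(mulrC b).
  by rewrite addrA subrK !mulrA (mulrC a d) -!mulrA (mulrCA a e).
rewrite big_split /=.
rewrite [RHS](eq_bigr (fun k => (if k is j.+1 then S n j else 0)
   *: falling ('X : {poly R}) k
   + ((k%:R - n%:R * lambda) * S n k) *: falling ('X : {poly R}) k)); last first.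
  by move=> k _; rewrite scalerDl.
rewrite [RHS]big_split /= [X in _ = X + _]big_nat_recl // scale0r add0r.
congr (_ + _); rewrite [RHS]big_nat_recr //=.
by rewrite S0 // mulr0 scale0r addr0.
Qed.

Lemma deg_stirling2_unique (R : comNzRingType) (lambda : R)
    (S T : nat -> nat -> R) :
  is_deg_stirling2 lambda S -> is_deg_stirling2 lambda T ->
  forall n k : nat, (k <= n)%N -> S n k = T n k.
Proof.
move=> HS HT n k lekn.
have fm m : falling ('X : {poly R}) m \is monic.
  by apply: monic_prod => i _; rewrite -polyC_natr monicXsubC.
have fs m : size (falling ('X : {poly R}) m) = m.+1.
  rewrite /falling (eq_bigr (fun i : 'I_m => 'X - (i%:R : R)%:P)); last first.
    by move=> i _; rewrite polyC_natr.
  by rewrite size_prod_XsubC /index_enum -enumT size_enum_ord.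
have free N (c : nat -> R) :
    \sum_(0 <= i < N) c i *: falling ('X : {poly R}) i = 0 ->
    forall i, (i < N)%N -> c i = 0.
  elim: N => [//|N IH] H i.
  have cN : c N = 0.
    have := congr1 (fun p : {poly R} => p`_N) H.
    rewrite coef0 big_nat_recr //= coefD coefZ coef_sum big_nat big1 => [|j ltjN].
      rewrite add0r; have := fm N; rewrite monicE lead_coefE fs /=.
      by move/eqP->; rewrite mulr1.
    by rewrite coefZ nth_default ?mulr0 // fs; case/andP: ltjN.
  rewrite ltnS leq_eqVlt => /predU1P[->//|]; apply: IH.
  by move: H; rewrite big_nat_recr //= cN scale0r addr0.
apply/eqP; rewrite -subr_eq0; apply/eqP.
apply: (free n.+1 (fun k => S n k - T n k)); last by [].
rewrite (eq_bigr (fun k => S n k *: falling ('X : {poly R}) k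
  - T n k *: falling ('X : {poly R}) k)); last by move=> i _; rewrite scalerBl.
by rewrite sumrB -HS -HT subrr.
Qed.

(* Main.v *)
Require Import Defs.
From mathcomp Require Import all_boot all_order all_algebra.
From mathcomp Require Import reals.
From mathcomp Require Import ring.
Import GRing.Theory.
Local Open Scope ring_scope.

(** Multiplying [(x)_{n,lambda} = \sum_k S n k (x)_k] by [x - n lambda] and using
    [(x - n lambda) (x)_k = (x)_{k+1} + (k - n lambda) (x)_k] gives the triangular
    recurrence
      [S (n+1) (l+1) = S n l + (l + 1 - n lambda) S n (l+1)]
    ([deg_stirling2_rec], with boundary case [deg_stirling2_diag]).
    Unfolding it repeatedly in the last term, from row [k+1] down to row [l+1],
    yields the summands [S m l], each with the coefficient
      [(l + 1 - k lambda) (l + 1 - (k-1) lambda) ... (l + 1 - (m+1) lambda)].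
    Read from its first factor, this product increases in steps of [lambda]: it
    is the degenerate rising factorial of length [k - m] at [l + 1 - k lambda].
    Formally the unfolding is an induction on [k], and [deg_risingS] peels off
    the first factor. *)

Lemma deg_fallingS (V : comNzRingType) (lambda x : V) (n : nat) :
  deg_falling lambda x n.+1 = deg_falling lambda x n * (x - n%:R * lambda).
Proof. by rewrite /deg_falling big_ord_recr. Qed.

Lemma fallingS (V : comNzRingType) (x : V) (n : nat) :
  falling x n.+1 = falling x n * (x - n%:R).
Proof. by rewrite /falling big_ord_recr. Qed.

Lemma deg_risingS (V : comNzRingType) (lambda x : V) (n : nat) :
  deg_rising lambda x n.+1 = x * deg_rising lambda (x + lambda) n.
Proof.
rewrite /deg_rising big_ord_recl mul0r addr0; congr (_ * _).
by apply: eq_bigr => i _; rewrite lift0 -natr1; ring.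
Qed.

(** Row [n.+1] computed from row [n] of [S]. The values of [S] above the
    diagonal are arbitrary, hence the explicit truncation at [k <= n]. *)
Definition next_row (R : comNzRingType) (lambda : R) (S : nat -> nat -> R)
    (n k : nat) : R :=
  (if k is j.+1 then S n j else 0) +
  (k%:R - n%:R * lambda) * (if (k <= n)%N then S n k else 0).

Lemma deg_falling_next_row (R : comNzRingType) (lambda : R)
    (S : nat -> nat -> R) (n : nat) :
  is_deg_stirling2 lambda S ->
  deg_falling lambda%:P 'X n.+1 =
    \sum_(0 <= k < n.+2) next_row R lambda S n k *: falling ('X : {poly R}) k.
Proof.
move=> hS; rewrite deg_fallingS hS mulr_suml.
under [RHS]eq_bigr do rewrite scalerDl.
(* In row [n.+1] the shifted part lacks its [k = 0] term and the diagonal part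
   its [k = n.+1] term, so both reduce to sums over [k <= n]. *)
rewrite [RHS]big_split /= [X in _ = X + _]big_nat_recl //= scale0r add0r.
rewrite [X in _ = _ + X]big_nat_recr //= ltnn mulr0 scale0r addr0 -big_split /=.
apply: eq_big_nat => k /andP[_ ltkn]; rewrite -ltnS ltkn fallingS.
by rewrite -!mul_polyC !(polyCM, polyCB, polyC_natr); ring.
Qed.

(** The rows of [S] and their successors expand the same polynomials, so the
    uniqueness of coordinates in the basis of falling factorials identifies
    them. *)
Lemma deg_stirling2_next_row (R : comNzRingType) (lambda : R)
    (S : nat -> nat -> R) (n k : nat) :
  is_deg_stirling2 lambda S -> (k <= n.+1)%N ->
  S n.+1 k = next_row R lambda S n k.
Proof.
move=> hS.
pose T i := if i is j.+1 then next_row R lambda S j else S 0.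
have hT : is_deg_stirling2 lambda T.
  by case=> [|i]; [exact: hS | exact: deg_falling_next_row].
exact: (deg_stirling2_unique hS hT).
Qed.

Lemma deg_stirling2_diag (R : comNzRingType) (lambda : R)
    (S : nat -> nat -> R) (n : nat) :
  is_deg_stirling2 lambda S -> S n.+1 n.+1 = S n n.
Proof.
move=> hS; rewrite (deg_stirling2_next_row _ _ _ _ _ hS) // /next_row ltnn.
by rewrite mulr0 addr0.
Qed.

Lemma deg_stirling2_rec (R : comNzRingType) (lambda : R)
    (S : nat -> nat -> R) (n l : nat) :
  is_deg_stirling2 lambda S -> (l < n)%N ->
  S n.+1 l.+1 = S n l + (l.+1%:R - n%:R * lambda) * S n l.+1.
Proof.
move=> hS ltln; rewrite (deg_stirling2_next_row _ _ _ _ _ hS) /next_row ?ltln //.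
exact: ltnW.
Qed.

Theorem theorem7 (R : realType) (lambda : R) (S : nat -> nat -> R)
    (hS : is_deg_stirling2 lambda S) (l k : nat) (hlk : (l <= k)%N) :
  S k.+1 l.+1 =
    \sum_(l <= m < k.+1)
      deg_rising lambda (l.+1%:R - k%:R * lambda) (k - m) * S m l.
Proof.
have rising0 x : deg_rising lambda x 0 = 1 by rewrite /deg_rising big_ord0.
elim: k hlk => [|k IH].
  rewrite leqn0 => /eqP ->.
  by rewrite big_nat1 rising0 mul1r (deg_stirling2_diag _ _ _ _ hS).
rewrite leq_eqVlt => /predU1P[->|ltlk].
  by rewrite big_nat1 subnn rising0 mul1r (deg_stirling2_diag _ _ _ _ hS).
rewrite (deg_stirling2_rec _ _ _ _ _ hS ltlk) IH //.
rewrite [RHS]big_nat_recr /= ?(ltnW ltlk) // subnn rising0 mul1r addrC.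
congr (_ + _); rewrite mulr_sumr; apply: eq_big_nat => m /andP[_ ltmk].
rewrite subSn // deg_risingS mulrA; congr (_ * deg_rising _ _ _ * _).
by rewrite -(natr1 k); ring.
Qed.
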